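(* Let $n=2m$ with $m$ a positive integer, let $S\subseteq D_n$ be non-empty with $1\notin S$ and $S=S^{-1}$, and suppose that $\mathrm{Cay}(D_n,S)$ is non-normal. Then $\mathrm{Cay}(D_n,S)$ exhibits PST between the vertices $u$ and $v$ at time $\tau$ if and only if exactly one of the following holds. (A) $(u,v)\in(G_0\times G_0)\cup(G_1\times G_1)$ with $u-v=\pm m$, and the eigenvalues of the discriminant matrix $P$ satisfy (i) $T_\tau(\widetilde\mu_1)=T_\tau(\widetilde\mu_2)=1$, $T_\tau(\widetilde\mu_3)=T_\tau(\widetilde\mu_4)=(-1)^m$; (ii) $T_\tau(\mu_h)=(-1)^h$ for $1\le h\le m-1$ with $\eta_h(S_2)=0$; and (iii) $T_\tau(\mu_h^{(1)})=T_\tau(\mu_h^{(2)})=(-1)^h$ for $1\le h\le m-1$ with $\eta_h(S_2)\ne0$. (B) $(u,v)\in(G_0\times G_1)\cup(G_1\times G_0)$ with $\eta_h(S_2)\neq0$ for each $1\le h\le m-1$ and $S_2=a^{2|v-u|}S_2^{-1}$, and the eigenvalues of $P$ satisfy (i) $T_\tau(\widetilde\mu_1)=-T_\tau(\widetilde\mu_2)=1$, $T_\tau(\widetilde\mu_3)=-T_\tau(\widetilde\mu_4)=(-1)^{u+v}$; and (ii) $T_\tau(\mu_h^{(1)})=-T_\tau(\mu_h^{(2)})=\ell_h\,\omega_n^{|v-u|h}$ for $1\le h\le m-1$.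
   Context: Grover walk and PST. For a finite simple graph $G$, let $\mathcal{A}(G)=\{(u,v),(v,u):\{u,v\}\in E(G)\}$ be the set of arcs; for $a=(u,v)$ put $t(a)=v$ and $\bar a=(v,u)$. The shift matrix $R\in\mathbb{C}^{\mathcal{A}(G)\times\mathcal{A}(G)}$ has $R_{a,b}=1$ if $a=\bar b$ and $0$ otherwise. The boundary matrix $N\in\mathbb{C}^{V(G)\times\mathcal{A}(G)}$ has $N_{u,a}=1/\sqrt{\deg u}$ if $t(a)=u$ and $0$ otherwise. The transition matrix of the Grover walk is $U=R(2N^*N-I)$. The discriminant is $P=NRN^*$, which for a $k$-regular graph equals $\frac1k A$ with $A$ the adjacency matrix. For a vertex $u$, $\Phi_u=N^*\mathbf{e}_u$. $G$ exhibits perfect state transfer (PST) from $u$ to another vertex $v\ne u$ at time $\tau$ ($\tau$ a positive integer) if $U^\tau\Phi_u=\gamma\Phi_v$ for some $\gamma\in\mathbb{C}$ with $|\gamma|=1$; this relation is symmetric in $u,v$, so one says PST between $u$ and $v$. $T_k$ is the Chebyshev polynomial of the first kind. Dihedral Cayley graphs. $D_n=\langle a,b:a^n=1=b^2,\ bab=a^{-1}\rangle$ ($n\ge2$) has order $2n$; $\omega_n=e^{2\pi\sqrt{-1}/n}$. $\mathrm{Cay}(D_n,S)$ has vertex set $D_n$ and edges $\{x,y\}$ with $xy^{-1}\in S$; it is normal if $S$ is a union of conjugacy classes of $D_n$, otherwise non-normal. Vertices are labelled by integers: $u\in G_0:=\{0,\ldots,n-1\}$ stands for $a^u$, and $u\in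 G_1:=\{n,\ldots,2n-1\}$ stands for $ba^{u-n}$. Let $d=|S|$, $S_1=S\cap\langle a\rangle$, $S_2=bS\cap\langle a\rangle$ with $bS=\{bs:s\in S\}$, $S_2^{-1}=\{x^{-1}:x\in S_2\}$, $s_i=|S_i|$; $d_{i,0}$ (resp. $d_{i,1}$) is the number of $a^k\in S_i$, $0\le k\le n-1$, with $k$ even (resp. odd), $i=1,2$. For $C\subseteq\langle a\rangle$, $\eta_h(C)=\sum_{0\le k\le n-1,\ a^k\in C}\omega_n^{hk}$ (zero if $C=\emptyset$). The eigenvalues of $P$ are: $\widetilde\mu_1=1$, $\widetilde\mu_2=(s_1-s_2)/d$, $\widetilde\mu_3=(d_{1,0}-d_{1,1}+d_{2,0}-d_{2,1})/d$, $\widetilde\mu_4=(d_{1,0}-d_{1,1}+d_{2,1}-d_{2,0})/d$; for $1\le h\le m-1$ with $\eta_h(S_2)=0$, $\mu_h=\eta_h(S_1)/d$; for $1\le h\le m-1$ with $\eta_h(S_2)\ne0$, $\mu_h^{(1)}=\frac1d\left(\eta_h(S_1)+\sqrt{\eta_h(S_2)\eta_h(S_2^{-1})}\right)$ and $\mu_h^{(2)}=\frac1d\left(\eta_h(S_1)-\sqrt{\eta_h(S_2)\eta_h(S_2^{-1})}\right)$, where the radicand is $|\eta_h(S_2)|^2$ and the non-negative root is taken. When $\eta_h(S_2)\ne0$, $\ell_h=\sqrt{\eta_h(S_2^{-1})/\eta_h(S_2)}$, with the square root chosen so that $\ell_h\,\eta_h(S_2)=\sqrt{\eta_h(S_2)\eta_h(S_2^{-1})}$.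 *)

(* Defs.v *)
From HB Require Import structures.
From mathcomp Require Import all_boot all_order all_algebra all_fingroup all_solvable.
From mathcomp Require Import complex reals trigo.

Set Implicit Arguments.
Unset Strict Implicit.
Unset Printing Implicit Defensive.

Import Order.TTheory GRing.Theory Num.Theory.
Local Open Scope ring_scope.
Local Open Scope sesquilinear_scope.

Fixpoint chebyshevT (F : nzRingType) (k : nat) : {poly F} :=
  match k with
  | 0 => 1
  | k'.+1 => match k' with
             | 0 => 'X
             | k''.+1 => 2%:R *: 'X * chebyshevT F k' - chebyshevT F k''
             end
  end.

Definition exactly_one (A B : Prop) : Prop := (A /\ ~ B) \/ (~ A /\ B).

(* A simple graph is given by an adjacency relation [e] on a finite type,
   meant to be symmetric and irreflexive. *)
Section GroverWalk.
Variables (C : numClosedFieldType) (V : finType) (e : rel V).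

Definition graph_arc : finType := {p : V * V | e p.1 p.2}.

Definition arc_head (x : graph_arc) : V := (val x).2.

Definition is_reverse (x y : graph_arc) : bool :=
  ((val x).1 == (val y).2) && ((val x).2 == (val y).1).

Definition deg (u : V) : nat := #|[set v | e u v]|.

(* Rows and columns indexed by finite types [I] and [J] are numbered through
   the library enumerations of these types. *)
Definition fin_matrix (I J : finType) (f : I -> J -> C) : 'M[C]_(#|I|, #|J|) :=
  \matrix_(i, j) f (enum_val i) (enum_val j).

Definition shift_matrix : 'M[C]_(#|graph_arc|, #|graph_arc|) :=
  fin_matrix (fun x y : graph_arc => (is_reverse x y)%:R).

Definition boundary_matrix : 'M[C]_(#|V|, #|graph_arc|) :=
  fin_matrix (fun (u : V) (x : graph_arc) =>
    if arc_head x == u then (sqrtC (deg u)%:R)^-1 else 0).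

Definition grover_matrix : 'M[C]_#|graph_arc| :=
  shift_matrix *m
  (2%:R *: (boundary_matrix ^t* *m boundary_matrix) - 1%:M).

Definition discriminant : 'M[C]_#|V| :=
  boundary_matrix *m shift_matrix *m boundary_matrix ^t*.

Definition vertex_state (u : V) : 'cV[C]_#|graph_arc| :=
  boundary_matrix ^t* *m delta_mx (enum_rank u) 0.

Definition PST (u v : V) (tau : nat) : Prop :=
  [/\ v != u, (0 < tau)%N &
      exists2 gamma : C, `|gamma| = 1 &
        (grover_matrix ^+ tau) *m vertex_state u = gamma *: vertex_state v].

End GroverWalk.

Section DihedralCayley.
Variable gT : finGroupType.
Implicit Types (a b : gT) (S : {set gT}).

(* The whole group [gT] is the dihedral group D_n with distinguished generators
   [a] and [b]; the order condition excludes the proper quotients of the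
   presented group, see [dihedral_presentation]. *)
Definition dihedral_generators (n : nat) a b : Prop :=
  [/\ (a ^+ n = 1)%g, (b ^+ 2 = 1)%g, (b * a * b = a^-1)%g,
      <<[set a; b]>>%g = [set: gT] & #|gT| = (2 * n)%N].

Lemma dihedral_presentation (n : nat) a b :
  (1 < n)%N -> dihedral_generators n a b ->
  ([set: gT] \isog Grp (x : y : x ^+ n, y ^+ 2, y * x * y = x^-1))%g.
Proof.
move=> n_gt1 [an b2 bab gen_ab oG].
have bV (rT : finGroupType) (x y : rT) :
    (y ^+ 2 = 1)%g -> ((y * x * y)%g == x^-1%g) = ((x ^ y)%g == x^-1%g).
  move=> y2; have yV : (y^-1 = y)%g by apply/eqP; rewrite eq_invg_mul -(expgS y 1) y2.
  by rewrite conjgE yV mulgA.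
have isoD : [set: gT]%G \isog ('D_(n.*2))%G.
  rewrite isogEcard card_dihedral // cardsT oG mul2n leqnn andbT Grp_dihedral //.
  apply/existsP; exists (a, b); rewrite /= !xpair_eqE.
  have gen_ab' : ([set a] <*> [set b])%g = [set: gT] by [].
  by rewrite joing_idl joing_idr gen_ab' an b2 -bV // bab !eqxx.
apply: isoGrp_trans isoD _ => rT H; rewrite Grp_dihedral //.
apply: eq_existsb => -[x y] /=; rewrite !xpair_eqE.
by congr (_ && _); apply: andb_id2l => _; apply: andb_id2l => /eqP y2; rewrite bV.
Qed.

Definition cayley S : rel gT := fun x y => (x * y^-1)%g \in S.

Definition normal_connection_set S : Prop :=
  exists2 K : {set {set gT}}, K \subset classes [set: gT] & S = cover K.

Definition G0 (n : nat) : pred nat := fun u => (u < n)%N.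
Definition G1 (n : nat) : pred nat := fun u => (n <= u < 2 * n)%N.

Definition vertex (n : nat) a b (u : nat) : gT :=
  if (u < n)%N then (a ^+ u)%g else (b * a ^+ (u - n))%g.

Definition conn1 a S : {set gT} := S :&: <[a]>%g.
Definition conn2 a b S : {set gT} := (b *: S)%g :&: <[a]>%g.

Definition even_count (n : nat) a S : nat :=
  #|[set k : 'I_n | (a ^+ k \in S)%g && ~~ odd k]|.
Definition odd_count (n : nat) a S : nat :=
  #|[set k : 'I_n | (a ^+ k \in S)%g && odd k]|.

Section Eigenvalues.
Variable R : realType.

Definition omega (n : nat) : R[i] :=
  (cos (2%:R * pi / n%:R) +i* sin (2%:R * pi / n%:R))%C.

Definition eta_sum (n : nat) a (h : nat) (K : {set gT}) : R[i] :=
  \sum_(k < n | (a ^+ k)%g \in K) omega n ^+ (h * k).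

Variables (n : nat) (a b : gT) (S : {set gT}).

Local Notation d := (#|S|%:R : R[i]).
Local Notation s1 := (#|conn1 a S|%:R : R[i]).
Local Notation s2 := (#|conn2 a b S|%:R : R[i]).
Local Notation d10 := ((even_count n a (conn1 a S))%:R : R[i]).
Local Notation d11 := ((odd_count n a (conn1 a S))%:R : R[i]).
Local Notation d20 := ((even_count n a (conn2 a b S))%:R : R[i]).
Local Notation d21 := ((odd_count n a (conn2 a b S))%:R : R[i]).
Local Notation eta1 h := (eta_sum n a h (conn1 a S)).
Local Notation eta2 h := (eta_sum n a h (conn2 a b S)).
Local Notation eta2V h := (eta_sum n a h (conn2 a b S)^-1%g).

(* The eigenvalues of [discriminant R[i] (cayley S)] when n = 2m;
   the index h below ranges over 1 <= h <= m - 1. *)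
Definition mut1 : R[i] := 1.
Definition mut2 : R[i] := (s1 - s2) / d.
Definition mut3 : R[i] := (d10 - d11 + d20 - d21) / d.
Definition mut4 : R[i] := (d10 - d11 + d21 - d20) / d.

Definition mu (h : nat) : R[i] := eta1 h / d.

(* [sqrtC] is the non-negative root on non-negative radicands, and
   eta2 h * eta2V h = |eta2 h|^2. *)
Definition mu1 (h : nat) : R[i] := (eta1 h + sqrtC (eta2 h * eta2V h)) / d.
Definition mu2 (h : nat) : R[i] := (eta1 h - sqrtC (eta2 h * eta2V h)) / d.

(* The square root of eta2V h / eta2 h whose product with eta2 h is
   sqrtC (eta2 h * eta2V h); meaningful when eta2 h != 0, see [ellP]. *)
Definition ell (h : nat) : R[i] :=
  let r := sqrtC (eta2V h / eta2 h) in
  if r * eta2 h == sqrtC (eta2 h * eta2V h) then r else - r.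

Lemma ellP (h : nat) : eta2 h != 0 ->
  ell h ^+ 2 = eta2V h / eta2 h /\
  ell h * eta2 h = sqrtC (eta2 h * eta2V h).
Proof.
rewrite /ell => nz; set r := sqrtC _; set q := sqrtC (_ * _).
have r2 : r ^+ 2 = eta2V h / eta2 h by rewrite sqrtCK.
have : (r * eta2 h) ^+ 2 = q ^+ 2.
  by rewrite sqrtCK exprMn r2 expr2 mulrA divfK // mulrC.
move/eqP; rewrite eqf_sqr; case: eqP => [-> //|_] /= /eqP rq.
by rewrite sqrrN mulNr rq opprK.
Qed.

End Eigenvalues.
End DihedralCayley.

(* Main.v *)
Require Import Defs.
From HB Require Import structures.
From mathcomp Require Import all_boot all_order all_algebra all_fingroup all_solvable.
From mathcomp Require Import complex reals trigo.
From mathcomp Require Import zify ring lra.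

Set Implicit Arguments.
Unset Strict Implicit.
Unset Printing Implicit Defensive.

Import Order.TTheory GRing.Theory Num.Theory.
Local Open Scope ring_scope.

(** Write [d] for the degree of the graph.  Each step of
    the walk is a product of two reflections, and compressing its powers by the
    boundary matrix [N] gives the Chebyshev polynomials of the discriminant:
    if [y *m P = mu *: y] then [y *m (N *m U ^+ k *m N ^t* )] is [T_k(mu)] times
    [y] ([walk_chebyshev]).  Hence PST from [u] to [v] forces
    [T_tau(mu) * y u = y v] for every eigenfunction [y]; the constant
    eigenfunction, of eigenvalue 1, shows that the scalar [gamma] is 1
    ([PST_eigenfunction]).  Conversely, if these equations hold for a spanning
    family of eigenfunctions, then [N] maps [U ^+ tau *m Phi_u] to the unit
    vector at [v]; since [U ^+ tau *m Phi_u] is itself a unit vector, it must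
    be [Phi_v] ([PST_of_eigenfunctions]).

    For the dihedral graph, let [phi h] be the h-th character of the rotation
    group, extended by zero to the reflections.  Left multiplication by the
    connection set preserves the plane spanned by [phi h] and
    [x |-> phi h (b * x)], and acts on it by the matrix with diagonal entries
    [eta_h(S_1)] and off-diagonal entries [eta_h(S_2)] and its conjugate.
    Writing [eta_h(S_2) = r * c^*] with [r] real and [c] unimodular, the
    functions [phi h x + c * phi h (b * x)] and
    [phi h x - c * phi h (b * x)] are eigenfunctions with eigenvalues
    [(eta_h(S_1) + r) / d] and [(eta_h(S_1) - r) / d]
    ([branch_eigenfunction]).  For [0 <= h <= m] they span all functions on the
    group, once their complex conjugates are added ([rot_char_total]).

    The theorem is then a computation with the values of these eigenfunctions
    at [u] and [v].  If both vertices are rotations or both are reflections, the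
    equations read [T_tau(mu) = omega ^ (h * (v - u))] on both branches.  The
    left side is real, so the case [h = 1] forces [v - u = m] or [v - u = - m],
    and the right side is [(-1) ^ h] ([PST_same_side]).  If one vertex is a
    rotation and the other a reflection, they read
    [T_tau(mu) = c * omega ^ (h * |v - u|)] on one branch and the opposite on
    the other ([PST_cross_side]).  The two branches coincide when
    [eta_h(S_2) = 0], which is therefore excluded; and the reality of
    [c * omega ^ (h * |v - u|)] says that [eta_h(S_2)] and
    [eta_h(a ^ (2 * |v - u|) S_2^-1)] are equal, which for all [h] at once is
    the required identity between the sets ([conn2_reflection_invariant]). *)

(** * Chebyshev polynomials and products of two reflections *)

Lemma chebyshevT_rec (F : comNzRingType) k (x : F) :
  (chebyshevT F k.+2).[x]
    = 2%:R * x * (chebyshevT F k.+1).[x] - (chebyshevT F k).[x].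
Proof.
by rewrite [chebyshevT F k.+2]/= hornerD hornerN hornerM hornerZ hornerX.
Qed.

Lemma chebyshevT_1 (F : comNzRingType) k : (chebyshevT F k).[1] = 1.
Proof.
suff [] : (chebyshevT F k).[1] = 1 /\ (chebyshevT F k.+1).[1] = 1 by [].
elim: k => [|k [IH1 IH2]]; first by rewrite /= hornerC hornerX.
by split=> //; rewrite chebyshevT_rec IH1 IH2 !mulr1 mulr2n addrK.
Qed.

Lemma chebyshevT_real (C : numClosedFieldType) k (x : C) :
  x \is Num.real -> (chebyshevT C k).[x] \is Num.real.
Proof.
move=> xR.
suff [] : (chebyshevT C k).[x] \is Num.real /\
          (chebyshevT C k.+1).[x] \is Num.real by [].
elim: k => [|k [IH1 IH2]]; first by rewrite /= hornerC hornerX rpred1.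
by split=> //; rewrite chebyshevT_rec rpredB // !rpredM // realn.
Qed.

Section TwoReflections.
Local Open Scope sesquilinear_scope.
Variables (C : numClosedFieldType) (p q : nat).
Variables (N : 'M[C]_(p, q)) (W : 'M[C]_q).
Hypothesis N_coisometry : N *m N ^t* = 1%:M.
Hypothesis W_invol : W *m W = 1%:M.

Let K : 'M[C]_q := 2%:R *: (N ^t* *m N) - 1%:M.
Let U : 'M[C]_q := W *m K.
Let P : 'M[C]_p := N *m W *m N ^t*.

Lemma adjmxM (s t w : nat) (A : 'M[C]_(s, t)) (B : 'M[C]_(t, w)) :
  (A *m B) ^t* = B ^t* *m A ^t*.
Proof. by rewrite trmx_mul map_mxM. Qed.

Lemma adjmxB (s t : nat) (A B : 'M[C]_(s, t)) : (A - B) ^t* = A ^t* - B ^t*.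
Proof. by rewrite linearB map_mxB. Qed.

Lemma mulmx_coin : N *m K = N.
Proof.
rewrite mulmxBr mulmx1 -scalemxAr mulmxA N_coisometry mul1mx.
by rewrite scaler_nat mulr2n addrK.
Qed.

Lemma coin_mulmx : K *m N ^t* = N ^t*.
Proof.
rewrite mulmxBl mul1mx -scalemxAl -mulmxA N_coisometry mulmx1.
by rewrite scaler_nat mulr2n addrK.
Qed.

Lemma coin_invol : K *m K = 1%:M.
Proof.
rewrite {1}/K mulmxBl mul1mx -scalemxAl -mulmxA mulmx_coin.
by rewrite /K opprB addrC subrK.
Qed.

Lemma adj_coin : K ^t* = K.
Proof.
rewrite /K adjmxB linearZ /= map_mxZ trmx1 map_mx1 /= rmorph_nat.
by rewrite adjmxM trmxCK.
Qed.

Lemma walk_inverse : (K *m W) *m U = 1%:M.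
Proof. by rewrite /U mulmxA -(mulmxA K) W_invol mulmx1 coin_invol. Qed.

(** The inverse of the walk [U = W K] is [K W], and [N K = N] because [K] is the
    reflection that fixes the range of [N ^t*]; so [N (U + U^-1)] is
    [N W (K + 1)], where [K + 1] is twice the projection on that range.  This is
    the source of the three-term Chebyshev recurrence. *)
Lemma walk_sum : N *m (U + K *m W) = 2%:R *: (P *m N).
Proof.
rewrite mulmxDr /U !mulmxA mulmx_coin /K mulmxBr mulmx1 subrK.
by rewrite -scalemxAr /P !mulmxA.
Qed.

Lemma walk_rec k :
  N *m U ^+ k.+2 *m N ^t* =
    2%:R *: (P *m (N *m U ^+ k.+1 *m N ^t*)) - N *m U ^+ k *m N ^t*.
Proof.
have -> : P *m (N *m U ^+ k.+1 *m N ^t*) = P *m N *m U ^+ k.+1 *m N ^t*.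
  by rewrite !mulmxA.
rewrite 2!scalemxAl -walk_sum mulmxDr 2!mulmxDl.
have E : K *m W *m U ^+ k.+1 = U ^+ k.
  by rewrite exprS -[U * _]/(U *m _) mulmxA walk_inverse mul1mx.
by rewrite -(mulmxA N U) -[U *m U ^+ k.+1]exprS -(mulmxA N (K *m W)) E addrK.
Qed.

Lemma walk_chebyshev (y : 'rV[C]_p) mu k : y *m P = mu *: y ->
  y *m (N *m U ^+ k *m N ^t*) = (chebyshevT C k).[mu] *: y.
Proof.
move=> yP.
pose Q j := y *m (N *m U ^+ j *m N ^t*) = (chebyshevT C j).[mu] *: y.
suff [] : Q k /\ Q k.+1 by [].
elim: k => [|k [IH1 IH2]].
  rewrite /Q /= hornerC hornerX scale1r expr0 expr1; split.
    by rewrite [N *m _]mulmx1 N_coisometry mulmx1.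
  by rewrite -yP /P /U -(mulmxA N) -(mulmxA W) coin_mulmx !mulmxA.
split=> //; rewrite /Q walk_rec mulmxBr -scalemxAr (mulmxA y P) yP -scalemxAl.
by rewrite IH1 IH2 chebyshevT_rec !scalerA scalerBl.
Qed.

Hypothesis W_herm : W ^t* = W.

Lemma walk_unitary k : (U ^+ k) ^t* *m U ^+ k = 1%:M.
Proof.
have U1 : U ^t* *m U = 1%:M.
  by rewrite adjmxM adj_coin W_herm walk_inverse.
elim: k => [|k IH]; first by rewrite expr0 trmx1 map_mx1 mulmx1.
rewrite exprS -[U * _]/(U *m _) adjmxM mulmxA -(mulmxA _ (U ^t*)) U1 mulmx1.
exact: IH.
Qed.

(** The equality case of the Cauchy-Schwarz inequality: the unit vectors
    [U ^+ k *m (N ^t* *m x)] and [N ^t* *m z] have inner product [z ^t* *m z],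
    which is 1, so the norm of their difference vanishes. *)
Lemma walk_state_transfer (x z : 'cV[C]_p) k :
  x ^t* *m x = 1%:M -> z ^t* *m z = 1%:M ->
  N *m U ^+ k *m N ^t* *m x = z ->
  U ^+ k *m (N ^t* *m x) = N ^t* *m z.
Proof.
move=> x1 z1 Ez; apply/eqP; rewrite -subr_eq0.
set w := _ - _.
have Nx (t : 'cV[C]_p) : (N ^t* *m t) ^t* *m (N ^t* *m t) = t ^t* *m t.
  by rewrite adjmxM trmxCK -mulmxA (mulmxA N) N_coisometry mul1mx.
have Ux (t : 'cV[C]_q) : (U ^+ k *m t) ^t* *m (U ^+ k *m t) = t ^t* *m t.
  by rewrite adjmxM -mulmxA (mulmxA _ _ t) walk_unitary mul1mx.
have E : (N ^t* *m z) ^t* *m (U ^+ k *m (N ^t* *m x)) = 1%:M.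
  by rewrite adjmxM trmxCK -z1 -{3}Ez !mulmxA.
have E' : (U ^+ k *m (N ^t* *m x)) ^t* *m (N ^t* *m z) = 1%:M.
  by rewrite -[RHS]trmxCK trmx1 map_mx1 -E [RHS]adjmxM trmxCK.
have w0 : w ^t* *m w = 0.
  by rewrite /w adjmxB mulmxBl !mulmxBr E E' Nx z1 Ux Nx x1 !subrr.
apply/eqP; apply/matrixP => i j; rewrite (ord1 j) [RHS]mxE.
have := congr1 (fun A : 'M[C]_1 => A 0 0) w0; rewrite !mxE => /eqP.
rewrite psumr_eq0 => [|l _]; last by rewrite !mxE mulrC mul_conjC_ge0.
by move/allP/(_ i (mem_index_enum _)); rewrite !mxE mulrC mul_conjC_eq0 => /eqP.
Qed.
End TwoReflections.

(** * Perfect state transfer on regular graphs through eigenfunctions *)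

Lemma sum_enum_val (M : nmodType) (T : finType) (F : T -> M) :
  \sum_(i < #|T|) F (enum_val i) = \sum_x F x.
Proof. exact/esym/(@big_enum_val _ _ _ _ T F). Qed.

Section RegularGraph.
Local Open Scope sesquilinear_scope.
Variables (C : numClosedFieldType) (V : finType) (e : rel V) (k : nat).
Hypothesis e_sym : symmetric e.
Hypothesis k_gt0 : (0 < k)%N.
Hypothesis e_regular : forall x, deg e x = k.

Local Notation arc := (graph_arc e).
Local Notation N := (boundary_matrix C e).
Local Notation W := (shift_matrix C e).
Local Notation P := (discriminant C e).
Local Notation U := (grover_matrix C e).

Let s : C := (sqrtC k%:R)^-1.

Lemma conj_invsqrt : s^* = s.
Proof. by apply: CrealP; rewrite realV ger0_real // sqrtC_ge0 ler0n. Qed.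

Lemma invsqrt2 : s * s = k%:R^-1.
Proof. by rewrite -invfM -expr2 sqrtCK. Qed.

Lemma sum_arc_head u (F : V -> C) :
  \sum_(x : arc) (arc_head x == u)%:R * F (val x).1 = \sum_(w | e w u) F w.
Proof.
pose G (p : V * V) := (p.2 == u)%:R * F p.1.
rewrite -(big_sub (fun p : V * V => e p.1 p.2) G) /G.
rewrite -(pair_big_dep xpredT e (fun w t => (t == u)%:R * F w)) /= [RHS]big_mkcond.
apply: eq_bigr => w _; rewrite big_mkcond (bigD1 u) //= big1 => [|t tu].
  by rewrite eqxx mul1r addr0.
by rewrite (negbTE tu) mul0r if_same.
Qed.

Lemma deg_in x : (\sum_(w | e w x) 1 = k%:R :> C).
Proof.
rewrite sumr_const -(e_regular x) /deg; congr _%:R.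
by apply: eq_card => w; rewrite inE e_sym.
Qed.

Definition rev_arc (x : arc) : arc :=
  Sub ((val x).2, (val x).1) (etrans (e_sym _ _) (valP x)).

Lemma rev_arcK : involutive rev_arc.
Proof. by move=> x; apply/val_inj; rewrite /= -surjective_pairing. Qed.

Lemma is_reverseE x y : is_reverse x y = (y == rev_arc x).
Proof.
rewrite -val_eqE /is_reverse /= [sval y]surjective_pairing xpair_eqE.
by rewrite andbC eq_sym [_ == _.1]eq_sym.
Qed.

Lemma boundaryE u x :
  N (enum_rank u) (enum_rank x) = (arc_head x == u)%:R * s.
Proof.
by rewrite mxE !enum_rankK e_regular; case: eqP; rewrite ?mul1r ?mul0r.
Qed.

Lemma adj_boundaryE x u :
  (N ^t*) (enum_rank x) (enum_rank u) = (arc_head x == u)%:R * s.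
Proof. by rewrite mxE [in LHS]mxE boundaryE rmorphM rmorph_nat /= conj_invsqrt. Qed.

Lemma boundary_coisometry : N *m N ^t* = 1%:M.
Proof.
apply/matrixP => i j; rewrite -(enum_valK i) -(enum_valK j).
set u := enum_val i; set v := enum_val j; rewrite [LHS]mxE [RHS]mxE.
pose F (x : arc) := N (enum_rank u) (enum_rank x) * (N ^t*) (enum_rank x) (enum_rank v).
rewrite (eq_bigr (F \o enum_val)); last first.
  by move=> l _; rewrite /F /= (enum_valK l).
rewrite sum_enum_val /F.
rewrite (eq_bigr (fun x => (arc_head x == u)%:R * ((u == v)%:R / k%:R))); last first.
  move=> x _; rewrite boundaryE adj_boundaryE mulrACA invsqrt2.
  by case: (eqVneq (arc_head x) u) => [->|]; rewrite ?mul1r // !mul0r.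
rewrite (sum_arc_head u (fun=> _)) (inj_eq enum_rank_inj).
rewrite -[X in \sum_(w | _) X]mul1r -mulr_suml deg_in.
by rewrite mulrCA mulfV ?mulr1 // pnatr_eq0 -lt0n.
Qed.

Lemma shiftE x y : W (enum_rank x) (enum_rank y) = (y == rev_arc x)%:R.
Proof. by rewrite mxE !enum_rankK is_reverseE. Qed.

Lemma shift_invol : W *m W = 1%:M.
Proof.
apply/matrixP => i j; rewrite -(enum_valK i) -(enum_valK j).
set x := enum_val i; set z := enum_val j; rewrite [LHS]mxE [RHS]mxE.
pose F (y : arc) := W (enum_rank x) (enum_rank y) * W (enum_rank y) (enum_rank z).
rewrite (eq_bigr (F \o enum_val)); last by move=> l _; rewrite /F /= (enum_valK l).
rewrite sum_enum_val (bigD1 (rev_arc x)) //= big1 ?addr0 => [|y].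
  by rewrite /F !shiftE eqxx mul1r rev_arcK (inj_eq enum_rank_inj) eq_sym.
by rewrite /F shiftE => /negbTE->; rewrite mul0r.
Qed.

Lemma shift_herm : W ^t* = W.
Proof.
apply/matrixP => i j; rewrite -(enum_valK i) -(enum_valK j) 2!mxE.
by rewrite !shiftE rmorph_nat eq_sym (can2_eq rev_arcK rev_arcK).
Qed.

Definition vertex_row (y : V -> C) : 'rV[C]_#|V| := \row_j y (enum_val j).

Definition vertex_unit (u : V) : 'cV[C]_#|V| := delta_mx (enum_rank u) 0.

Lemma vertex_rowE y (z : 'cV[C]_#|V|) :
  (vertex_row y *m z) 0 0 = \sum_x y x * z (enum_rank x) 0.
Proof.
rewrite mxE -[RHS]sum_enum_val; apply: eq_bigr => i _.
by rewrite mxE enum_valK.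
Qed.

Lemma vertex_row_unit y u : vertex_row y *m vertex_unit u = (y u)%:M.
Proof.
apply/matrixP => i j; rewrite (ord1 i) (ord1 j) vertex_rowE [RHS]mxE eqxx mulr1n.
rewrite (bigD1 u) //= !mxE !eqxx mulr1 big1 ?addr0 // => x /negbTE xu.
by rewrite mxE (inj_eq enum_rank_inj) xu mulr0.
Qed.

Lemma vertex_unit_norm u : (vertex_unit u) ^t* *m vertex_unit u = 1%:M.
Proof.
rewrite trmx_delta map_delta_mx mul_delta_mx.
by apply/matrixP=> i j; rewrite !ord1 !mxE.
Qed.

(** The eigenvalue is normalized by the degree, to be one of the discriminant
    rather than of the adjacency matrix. *)
Definition eigenfunction (y : V -> C) (mu : C) : Prop :=
  forall x, \sum_(w | e w x) y w = k%:R * mu * y x.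

Lemma eigenfunction_row y mu :
  eigenfunction y mu -> vertex_row y *m P = mu *: vertex_row y.
Proof.
move=> Ey; rewrite /discriminant !mulmxA.
have E1 : vertex_row y *m N = \row_j (s * y (arc_head (enum_val j))).
  apply/rowP => j; rewrite -(enum_valK j); set x := enum_val j; rewrite !mxE.
  pose F u := y u * N (enum_rank u) (enum_rank x).
  rewrite (eq_bigr (F \o enum_val)); last first.
    by move=> l _; rewrite /F /= (enum_valK l) mxE.
  rewrite sum_enum_val (bigD1 (arc_head x)) //= big1 ?addr0 => [|u].
    by rewrite /F boundaryE eqxx mul1r mulrC enum_rankK.
  by rewrite /F boundaryE eq_sym => /negbTE->; rewrite mul0r mulr0.
have E2 : vertex_row y *m N *m W = \row_j (s * y (val (enum_val j)).1).
  rewrite E1; apply/rowP => j; rewrite -(enum_valK j).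
  set x := enum_val j; rewrite !mxE.
  pose F z := s * y (arc_head z) * W (enum_rank z) (enum_rank x).
  rewrite (eq_bigr (F \o enum_val)); last first.
    by move=> l _; rewrite /F /= (enum_valK l) mxE.
  rewrite sum_enum_val (bigD1 (rev_arc x)) //= big1 ?addr0 => [|z].
    by rewrite /F shiftE rev_arcK eqxx mulr1 enum_rankK.
  by rewrite /F shiftE eq_sym (can2_eq rev_arcK rev_arcK) => /negbTE->; rewrite mulr0.
rewrite E2; apply/rowP => j; rewrite -(enum_valK j).
set v := enum_val j; rewrite !mxE.
pose F (x : arc) := s * y (val x).1 * ((arc_head x == v)%:R * s).
rewrite (eq_bigr (F \o enum_val)); last first.
  move=> l _; rewrite /F /= -adj_boundaryE (enum_valK l); congr (_ * _).
  by rewrite mxE.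
rewrite sum_enum_val.
rewrite (eq_bigr (fun x => (arc_head x == v)%:R * (k%:R^-1 * y (val x).1))).
  rewrite (sum_arc_head v (fun w => k%:R^-1 * y w)).
  by rewrite -mulr_sumr Ey enum_rankK !mulrA mulVf ?mul1r // pnatr_eq0 -lt0n.
by move=> x _; rewrite /F mulrCA mulrAC invsqrt2.
Qed.

Lemma constant_eigenfunction : eigenfunction (fun=> 1) 1.
Proof. by move=> x; rewrite deg_in !mulr1. Qed.

Lemma eigenfunction_conj y mu :
  mu \is Num.real -> eigenfunction y mu -> eigenfunction (fun x => (y x)^*) mu.
Proof.
move=> /CrealP muR Ey x; rewrite -rmorph_sum Ey !rmorphM /= rmorph_nat.
by rewrite muR.
Qed.

(** The scalar [gamma] of the definition of PST is eliminated by comparison with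
    the constant eigenfunction, for which [T_tau(1) = 1]. *)
Lemma PST_eigenfunction u v tau y mu :
  PST C e u v tau -> eigenfunction y mu -> (chebyshevT C tau).[mu] * y u = y v.
Proof.
case=> _ _ [gamma _ Etau].
have transfer f nu : eigenfunction f nu -> (chebyshevT C tau).[nu] * f u = gamma * f v.
  move=> /eigenfunction_row /(walk_chebyshev boundary_coisometry shift_invol tau).
  move/(congr1 (mulmx^~ (vertex_unit u))); rewrite -scalemxAl vertex_row_unit.
  rewrite -!mulmxA -/(vertex_state C e u) Etau -scalemxAr -scalemxAr /vertex_state.
  rewrite (mulmxA N) boundary_coisometry mul1mx -/(vertex_unit v) vertex_row_unit.
  by move/matrixP/(_ 0 0); rewrite !mxE !eqxx !mulr1n => ->.
move=> /transfer->; have := transfer _ _ constant_eigenfunction.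
by rewrite chebyshevT_1 !mulr1 => <-; rewrite mul1r.
Qed.

(** Only a total family of eigenfunctions has to be tested; totality is stated
    by duality, as the vanishing of every [z] orthogonal to the family. *)
Lemma PST_of_eigenfunctions u v tau :
  u != v -> (0 < tau)%N ->
  (forall z : V -> C,
      (forall y mu, eigenfunction y mu -> (chebyshevT C tau).[mu] * y u = y v ->
         \sum_x y x * z x = 0) ->
      forall x, z x = 0) ->
  PST C e u v tau.
Proof.
move=> uv tau_gt0 total; split; rewrite 1?eq_sym //.
exists 1; rewrite ?normr1 // scale1r.
apply: (walk_state_transfer boundary_coisometry shift_invol shift_herm);
  rewrite ?vertex_unit_norm //.
apply/eqP; rewrite -subr_eq0; apply/eqP; set z := _ - _.
apply/matrixP => i j; rewrite (ord1 j) -(enum_valK i) [RHS]mxE.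
apply: (total (fun x => z (enum_rank x) 0)) => y mu Ey Tuv.
rewrite -vertex_rowE /z mulmxBr mulmxA.
rewrite (walk_chebyshev boundary_coisometry shift_invol tau (eigenfunction_row Ey)).
by rewrite -scalemxAl !vertex_row_unit !mxE !eqxx !mulr1n Tuv subrr.
Qed.

End RegularGraph.

(** * Dihedral groups and Fourier analysis on the rotations *)

Lemma omegaX (R : realType) n k :
  omega R n ^+ k = (cos (2%:R * pi / n%:R *+ k) +i* sin (2%:R * pi / n%:R *+ k))%C.
Proof.
elim: k => [|k IH]; first by rewrite expr0 !mulr0n cos0 sin0.
rewrite exprS IH [_ *+ k.+1]mulrS cosD sinD; apply/eqP; rewrite eq_complex /= eqxx /=.
by rewrite [X in X == _]addrC.
Qed.

Lemma omega_primitive (R : realType) n : (0 < n)%N -> n.-primitive_root (omega R n).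
Proof.
move=> n_gt0; have n_neq0 : n%:R != 0 :> R by rewrite pnatr_eq0 -lt0n.
apply/andP; split=> //; apply/forallP => -[k k_lt] /=; apply/eqP.
rewrite unity_rootE omegaX; case: (eqVneq k.+1 n) => [->|k1n].
  have -> : 2%:R * pi / n%:R *+ n = pi *+ 2 :> R.
    by rewrite -mulr_natr divfK // mulr_natl.
  by rewrite cos2pi sin2pi; apply/eqP.
apply/negbTE; rewrite eq_complex /= negb_and; apply/orP; left.
set x : R := pi * k.+1%:R / n%:R.
have -> : 2%:R * pi / n%:R *+ k.+1 = x *+ 2.
  by rewrite /x -mulr_natr -[RHS]mulr_natl mulrAC !mulrA.
have kn : (k.+1 < n)%N by rewrite ltn_neqAle k1n.
have x_pi : 0 < x < pi.
  rewrite /x -mulrA; apply/andP; split.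
    by rewrite mulr_gt0 ?pi_gt0 // divr_gt0 // ltr0n.
  by rewrite gtr_pMr ?pi_gt0 // ltr_pdivrMr ?ltr0n // mul1r ltr_nat.
apply: contraTneq (sin_gt0_pi x_pi) => cos1; rewrite lt_def negb_and negbK.
apply/orP; left; rewrite -sqrf_eq0 sin2cos2.
move: cos1; rewrite cos_mulr2n => cos1; apply/eqP; lra.
Qed.

Lemma omega_norm (R : realType) n k : (0 < n)%N -> `|omega R n ^+ k| = 1.
Proof.
move=> n_gt0; have w_prim := omega_primitive R n_gt0.
suff w1 : `|omega R n| = 1 by rewrite normrX w1 expr1n.
by apply/eqP; rewrite -(@pexpr_eq1 _ _ n) // -normrX prim_expr_order // normr1.
Qed.

Lemma omega_neq0 (R : realType) n k : (0 < n)%N -> omega R n ^+ k != 0.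
Proof. by move=> n_gt0; rewrite -normr_eq0 omega_norm ?oner_eq0. Qed.

Section DihedralGroup.
Variables (gT : finGroupType) (n : nat) (a b : gT).
Hypothesis gT_dihedral : dihedral_generators n a b.

Lemma dihedral_n_gt0 : (0 < n)%N.
Proof.
case: gT_dihedral => _ _ _ _ oG; have := cardG_gt0 [set: gT].
by rewrite cardsT oG muln_gt0.
Qed.

Lemma reflK (x : gT) : (b * (b * x))%g = x.
Proof. by case: gT_dihedral => _ b2 _ _ _; rewrite mulgA -(expgS b 1) b2 mul1g. Qed.

Lemma reflV : (b^-1)%g = b.
Proof. by apply/(mulgI b); rewrite mulgV -[RHS]mulg1 -mulgA reflK. Qed.

Lemma refl_conj_rot x : x \in <[a]>%g -> (b * x * b)%g = (x^-1)%g.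
Proof.
case: gT_dihedral => _ _ bab _ _ /cycleP[k ->].
have -> : (b * a ^+ k * b)%g = ((a ^+ k) ^ b)%g by rewrite conjgE reflV mulgA.
by rewrite conjXg conjgE reflV mulgA bab expgVn.
Qed.

(** The order [2 * n] leaves no room for a collapse: [a] has order at most [n]
    and [b] order at most 2, while the product of the two cyclic groups is the
    whole group.  So all these bounds are attained, and [b] is not a rotation. *)
Lemma rot_refl_facts :
  [/\ #[a]%g = n, b \notin <[a]>%g & (<[a]> * <[b]>)%g = [set: gT]].
Proof.
case: gT_dihedral => an b2 bab gen_ab oG.
have n_gt0 := dihedral_n_gt0.
have oa : (#[a]%g <= n)%N by rewrite dvdn_leq // order_dvdn an.
have ob : (#[b]%g <= 2)%N by rewrite dvdn_leq // order_dvdn b2.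
have nab : <[b]>%g \subset 'N(<[a]>)%g.
  rewrite cycle_subG inE -cycleJ conjgE.
  by rewrite {1}reflV mulgA bab cycleV.
have prodG : (<[a]> * <[b]>)%g = [set: gT].
  by rewrite -norm_joinEr // -gen_ab joing_idl joing_idr.
have := mul_cardG <[a]> <[b]>; rewrite prodG cardsT oG -!orderE => E.
have I_gt0 := cardG_gt0 (<[a]> :&: <[b]>)%G.
have leab : (#[a]%g * #[b]%g <= n * 2)%N by apply: leq_mul.
have EI : #|<[a]> :&: <[b]>|%g = 1%N by move: E I_gt0 => /=; nia.
have Eb : #[b]%g = 2 by move: E; rewrite EI; nia.
have Ea : #[a]%g = n by move: E; rewrite EI Eb; nia.
split=> //; apply/negP => ba.
have : b \in (<[a]> :&: <[b]>)%g by rewrite inE ba cycle_id.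
rewrite (card1_trivg EI) => /set1P b1.
by rewrite b1 order1 in Eb.
Qed.

Lemma rot_order : #[a]%g = n.
Proof. by case: rot_refl_facts. Qed.

Lemma refl_notin : b \notin <[a]>%g.
Proof. by case: rot_refl_facts. Qed.

Lemma mem_refl_mul x : ((b * x)%g \in <[a]>%g) = (x \notin <[a]>%g).
Proof.
have [xa|xNa] := boolP (x \in _).
  by apply/negbTE; rewrite groupMr // refl_notin.
have : x \in (<[a]> * <[b]>)%g by case: rot_refl_facts => _ _ ->; rewrite inE.
case/mulsgP => y z ya /cycleP[k ->] xE; move: xNa; rewrite xE.
have b2 : (b ^+ 2 = 1)%g by case: gT_dihedral.
have -> : (b ^+ k = b ^+ odd k)%g.
  by rewrite -{1}(odd_double_half k) expgD -mul2n expgM b2 expg1n mulg1.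
case: (odd k); first by rewrite expg1 mulgA refl_conj_rot // groupV.
by rewrite expg0 mulg1 ya.
Qed.

Lemma dihedral_elimT (T : gT -> Prop) :
  (forall k, T (a ^+ k)%g) -> (forall k, T (b * a ^+ k)%g) -> forall x, T x.
Proof.
move=> Trot Trefl x; have [/cycleP[k ->] //|] := boolP (x \in <[a]>%g).
by rewrite -mem_refl_mul => /cycleP[k bx]; rewrite -(reflK x) bx.
Qed.

End DihedralGroup.

Section Fourier.
Variables (R : realType) (gT : finGroupType) (n : nat) (a b : gT).
Hypothesis gT_dihedral : dihedral_generators n a b.
Local Notation C := R[i].
Local Notation w := (omega R n).

Let n_gt0 := dihedral_n_gt0 gT_dihedral.
Let w_prim : n.-primitive_root w := omega_primitive R n_gt0.

(** The h-th character of [<[a]>], extended by zero to the whole group; summing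
    over the exponents spares the choice of a logarithm of [x]. *)
Definition rot_char (h : nat) (x : gT) : C :=
  \sum_(k < n | (a ^+ k)%g == x) w ^+ (h * k).

Lemma rot_char_rot h k : rot_char h (a ^+ k)%g = w ^+ (h * k).
Proof.
rewrite /rot_char (big_pred1 (Ordinal (ltn_pmod k n_gt0))) => [|i] /=.
  by rewrite mulnC exprM [in RHS]mulnC [RHS]exprM prim_expr_mod.
rewrite eq_expg_mod_order (rot_order gT_dihedral) -val_eqE /=.
by rewrite modn_small.
Qed.

Lemma rot_char_out h x : x \notin <[a]>%g -> rot_char h x = 0.
Proof.
move=> xNa; apply: big_pred0 => k; apply: contraNF xNa => /eqP <-.
exact: mem_cycle.
Qed.

Lemma rot_charM h x y : x \in <[a]>%g ->
  rot_char h (x * y)%g = rot_char h x * rot_char h y.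
Proof.
move=> xa; have [ya|yNa] := boolP (y \in <[a]>%g).
  case/cycleP: xa => i ->; case/cycleP: ya => j ->.
  by rewrite -expgD !rot_char_rot mulnDr exprD.
by rewrite (rot_char_out h yNa) mulr0 rot_char_out // groupMl.
Qed.

Lemma rot_charV h x : rot_char h (x^-1)%g = (rot_char h x)^*.
Proof.
have [xa|xNa] := boolP (x \in <[a]>%g); last first.
  by rewrite !rot_char_out ?conjC0 // groupV.
have E : rot_char h x * rot_char h (x^-1)%g = 1.
  by rewrite -rot_charM // mulgV -(expg0 a) rot_char_rot muln0.
case/cycleP: xa E => k ->; rewrite rot_char_rot => E.
have U : w ^+ (h * k) * (w ^+ (h * k))^* = 1 by rewrite -normCK omega_norm // expr1n.
by apply: (mulfI (omega_neq0 R (h * k) n_gt0)); rewrite E U.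
Qed.

Lemma rot_char_conj h x : rot_char h (b * x * b)%g = (rot_char h x)^*.
Proof.
have [xa|xNa] := boolP (x \in <[a]>%g).
  by rewrite (refl_conj_rot gT_dihedral) // rot_charV.
rewrite (rot_char_out h xNa) conjC0 rot_char_out // groupMl.
  by rewrite (refl_notin gT_dihedral).
by rewrite (mem_refl_mul gT_dihedral).
Qed.

Lemma eta_sumE h (K : {set gT}) : eta_sum R n a h K = \sum_(x in K) rot_char h x.
Proof.
rewrite /rot_char (exchange_big_dep xpredT) //= /eta_sum big_mkcond.
apply: eq_bigr => k _; have [aK|aNK] := boolP ((a ^+ k)%g \in K).
  rewrite (big_pred1 (a ^+ k)%g) // => x /=; rewrite [X in _ && X]eq_sym andbC.
  by case: eqP => // ->.
by rewrite big_pred0 // => x; apply: contraNF aNK => /andP[xK /eqP->].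
Qed.

Lemma eta_sumV h (K : {set gT}) : eta_sum R n a h (K^-1)%g = (eta_sum R n a h K)^*.
Proof.
rewrite !eta_sumE rmorph_sum (reindex_inj invg_inj) /=.
by apply: eq_big => x; rewrite ?inE ?invgK // => _; rewrite rot_charV.
Qed.

Lemma eta_sum_translate h j (K : {set gT}) :
  eta_sum R n a h (a ^+ j *: K)%g = w ^+ (h * j) * eta_sum R n a h K.
Proof.
rewrite !eta_sumE big_distrr (reindex_inj (mulgI (a ^+ j)%g)) /=.
apply: eq_big => x; rewrite ?mem_lcoset ?mulKg // => _.
by rewrite rot_charM ?mem_cycle // rot_char_rot.
Qed.

Lemma sum_rot_char h (z : gT -> C) :
  \sum_x rot_char h x * z x = \sum_(k < n) w ^+ (h * k) * z (a ^+ k)%g.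
Proof.
under eq_bigr do rewrite big_distrl /=.
rewrite (exchange_big_dep xpredT) //=; apply: eq_bigr => k _.
by rewrite (big_pred1 (a ^+ k)%g) // => x /=; rewrite eq_sym.
Qed.

Lemma rot_char_compl h x : (h <= n)%N -> rot_char (n - h) x = (rot_char h x)^*.
Proof.
move=> hn; rewrite /rot_char rmorph_sum; apply: eq_bigr => k _.
apply: (mulfI (omega_neq0 R (h * k) n_gt0)).
rewrite -normCK omega_norm // expr1n -exprD -mulnDl subnKC //.
by rewrite exprM (prim_expr_order w_prim) // expr1n.
Qed.

(** The values [z (a ^+ k)] are the coefficients of a polynomial of size at most
    [n] that vanishes at the [n] powers of [omega].  Half of these powers are
    reached by [phi h] with [h <= m], the others by its conjugate. *)
Lemma rot_char_total (m : nat) (z : gT -> C) : (n <= 2 * m)%N ->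
  (forall h, (h <= m)%N ->
     \sum_x rot_char h x * z x = 0 /\ \sum_x (rot_char h x)^* * z x = 0) ->
  forall k, z (a ^+ k)%g = 0.
Proof.
move=> n2m zh.
have zn h : (h < n)%N -> \sum_x rot_char h x * z x = 0.
  move=> hn; have [/zh[]//|mh] := leqP h m.
  have [|_] := zh (n - h)%N; first by lia.
  by under eq_bigr do rewrite -(rot_char_compl _ (leq_subr h n)) (subKn (ltnW hn)).
pose p := \poly_(k < n) z (a ^+ k)%g.
have p0 : p = 0.
  apply: (@roots_geq_poly_eq0 _ _ [seq w ^+ h | h <- iota 0 n]).
  - apply/allP => _ /mapP[h hn ->]; rewrite mem_iota in hn; apply/eqP.
    rewrite horner_poly -[RHS](zn h) ?sum_rot_char //; apply: eq_bigr => k _.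
    by rewrite mulrC exprM.
  - rewrite map_inj_in_uniq ?iota_uniq // => i j; rewrite !mem_iota => /= ii jj /eqP.
    by rewrite (eq_prim_root_expr w_prim) !modn_small // => /eqP.
  - by rewrite size_map size_iota size_poly.
(* The coefficients are indexed by exponents below n, hence the reduction. *)
move=> k; have := congr1 (fun q : {poly C} => q`_(k %% n)) p0.
rewrite coef_poly coef0 ltn_mod n_gt0 => <-; congr z.
by apply/eqP; rewrite eq_expg_mod_order (rot_order gT_dihedral) modn_mod.
Qed.

(** The difference of two indicators is real, so that orthogonality to a
    character gives orthogonality to its conjugate. *)
Lemma eta_sum_inj (m : nat) (K L : {set gT}) : (n <= 2 * m)%N ->
  K \subset <[a]>%g -> L \subset <[a]>%g ->
  (forall h, (h <= m)%N -> eta_sum R n a h K = eta_sum R n a h L) -> K = L.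
Proof.
move=> n2m Ka La etaKL.
pose z x : C := (x \in K)%:R - (x \in L)%:R.
have zh h : (h <= m)%N -> \sum_x rot_char h x * z x = 0.
  move=> hm; transitivity (eta_sum R n a h K - eta_sum R n a h L).
    rewrite !eta_sumE [X in _ = X - _]big_mkcond [X in _ = _ - X]big_mkcond -sumrB.
    apply: eq_bigr => x _; rewrite /z mulrBr.
    by case: (x \in K); case: (x \in L); rewrite ?mulr1 ?mulr0.
  by rewrite (etaKL h hm) subrr.
have z0 k : z (a ^+ k)%g = 0.
  apply: (rot_char_total n2m) => h hm; split; first exact: zh.
  transitivity (\sum_x rot_char h x * z x)^*; last by rewrite (zh h hm) conjC0.
  rewrite rmorph_sum; apply: eq_bigr => x _.
  by rewrite rmorphM /z rmorphB /= !rmorph_nat.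
apply/setP => x; have [/cycleP[k ->]|xNa] := boolP (x \in <[a]>%g).
  move/eqP: (z0 k); rewrite /z subr_eq0 eqr_nat.
  by case: (_ \in K); case: (_ \in L).
have out (M : {set gT}) : M \subset <[a]>%g -> x \in M = false.
  by move=> /subsetP Ma; apply: contraNF xNa => /Ma.
by rewrite !out.
Qed.
End Fourier.

(** * Eigenfunctions of dihedral Cayley graphs *)

Section CayleySpectrum.
Variables (R : realType) (gT : finGroupType) (m n : nat) (a b : gT) (S : {set gT}).
Hypothesis n_def : n = (2 * m)%N.
Hypothesis gT_dihedral : dihedral_generators n a b.
Hypothesis S_neq0 : S != set0.
Hypothesis S_inv : S = (S^-1)%g.

Local Notation C := R[i].
Local Notation phi := (rot_char R n a).
Local Notation eta1 h := (eta_sum R n a h (conn1 a S)).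
Local Notation eta2 h := (eta_sum R n a h (conn2 a b S)).
Local Notation T tau x := ((chebyshevT C tau).[x]).

Lemma card_conn_gt0 : (0 < #|S|)%N.
Proof. by rewrite card_gt0. Qed.

Lemma cayley_sym : symmetric (cayley S).
Proof. by move=> x y; rewrite /cayley {1}S_inv inE invMg invgK. Qed.

Lemma sum_cayley (M : nmodType) (f : gT -> M) x :
  \sum_(y | cayley S y x) f y = \sum_(s in S) f (s * x)%g.
Proof.
rewrite (reindex_inj (mulIg x)) /=.
by apply: eq_bigl => s; rewrite /cayley mulgK.
Qed.

Lemma cayley_regular x : deg (cayley S) x = #|S|.
Proof.
rewrite /deg -sum1_card -[RHS]sum1_card.
rewrite -(sum_cayley (M := nat) (fun=> 1%N) x).
by apply: eq_bigl => y; rewrite inE cayley_sym.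
Qed.

(** The reflections in [S] are the elements [b * t] with [t] in [conn2 a b S]. *)
Lemma sum_conn (M : nmodType) (f : gT -> M) :
  \sum_(s in S) f s =
    \sum_(t in conn1 a S) f t + \sum_(t in conn2 a b S) f (b * t)%g.
Proof.
rewrite (bigID (mem <[a]>%g)) /=; congr (_ + _).
  by apply: eq_bigl => s; rewrite /conn1 inE.
rewrite (reindex_inj (mulgI b)) /=; apply: eq_bigl => t.
rewrite /conn2 inE mem_lcoset (reflV gT_dihedral) (mem_refl_mul gT_dihedral).
by rewrite negbK.
Qed.

Lemma card_conn : (#|S| = #|conn1 a S| + #|conn2 a b S|)%N.
Proof. by rewrite -!sum1_card (sum_conn (M := nat)). Qed.

Lemma eta1_real h : eta1 h \is Num.real.
Proof.
apply/CrealP; rewrite -(eta_sumV _ gT_dihedral); congr (eta_sum _ _ _ _ _).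
by rewrite /conn1 invIg -S_inv invGid.
Qed.

(** A polar decomposition of [eta_h(S_2)] in which [r] may be negative; this
    covers both signs of the square root, and the exceptional indices [0] and
    [m], at once. *)
Definition branch_data h (r c : C) : Prop :=
  [/\ r \is Num.real, c * c^* = 1 & eta2 h = r * c^*].

(** The eigenfunction attached to the eigenvalue [(eta1 h + r) / d] by
    [branch_data h r c]; the other eigenvalue of the same plane is reached by
    changing the signs of both [r] and [c]. *)
Definition branch h (c : C) (x : gT) : C := phi h x + c * phi h (b * x)%g.

Lemma branch_dataN h r c : branch_data h r c -> branch_data h (- r) (- c).
Proof. by case=> rR cc E; split; rewrite ?rpredN // rmorphN /= mulrNN. Qed.

Lemma branch_eigenvalue_real h r c :
  branch_data h r c -> (eta1 h + r) / #|S|%:R \is Num.real.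
Proof. by case=> rR _ _; rewrite rpredM ?rpredV ?realn // rpredD // eta1_real. Qed.

(** Splitting [S] into rotations and reflections, a rotation [t] acts on [phi h]
    by [phi h t] and on [x |-> phi h (b * x)] by its conjugate, because [b]
    inverts [t]; a reflection [b * t] exchanges the two functions in the same
    manner. *)
Lemma branch_eigenfunction h r c : branch_data h r c ->
  eigenfunction (cayley S) #|S| (branch h c) ((eta1 h + r) / #|S|%:R).
Proof.
case=> /CrealP rR cc E x; rewrite sum_cayley sum_conn.
have S_neq : #|S|%:R != 0 :> C by rewrite pnatr_eq0 -lt0n card_conn_gt0.
rewrite mulrCA mulfV // mulr1.
have bx_conj t : (b * (t * x) = b * t * b * (b * x))%g.
  by rewrite -!mulgA (reflK gT_dihedral).
have rot_conj t : t \in <[a]>%g -> (b * t * b)%g \in <[a]>%g.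
  by move=> ta; rewrite (refl_conj_rot gT_dihedral) // groupV.
have -> : \sum_(t in conn1 a S) branch h c (t * x)%g = eta1 h * branch h c x.
  have -> : eta1 h * branch h c x =
      eta1 h * phi h x + (eta1 h)^* * (c * phi h (b * x)%g).
    by rewrite (CrealP (eta1_real h)) /branch mulrDr.
  rewrite !eta_sumE rmorph_sum !big_distrl -big_split /=.
  apply: eq_bigr => t; rewrite inE => /andP[_ ta]; rewrite /branch; congr (_ + _).
    by rewrite (rot_charM _ gT_dihedral).
  rewrite bx_conj (rot_charM _ gT_dihedral _ _ (rot_conj t ta)).
  by rewrite (rot_char_conj _ gT_dihedral) mulrCA.
rewrite [RHS]mulrDl; congr (_ + _).
have -> : r * branch h c x = (eta2 h)^* * phi h (b * x)%g + eta2 h * (c * phi h x).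
  rewrite E rmorphM /= conjCK rR /branch.
  rewrite (_ : r * c^* * (c * _) = r * (c * c^*) * phi h x); last by ring.
  by rewrite cc; ring.
rewrite !eta_sumE rmorph_sum !big_distrl -big_split /=.
apply: eq_bigr => t; rewrite inE => /andP[_ ta]; rewrite /branch; congr (_ + _).
  rewrite (_ : (b * t * x = b * t * b * (b * x))%g); last first.
    by rewrite -!mulgA (reflK gT_dihedral).
  rewrite (rot_charM _ gT_dihedral _ _ (rot_conj t ta)).
  by rewrite (rot_char_conj _ gT_dihedral).
by rewrite -mulgA (reflK gT_dihedral) (rot_charM _ gT_dihedral _ _ ta) mulrCA.
Qed.

Definition transfers tau (x y : gT) h r c : Prop :=
  T tau ((eta1 h + r) / #|S|%:R) * branch h c x = branch h c y.

(** The eigenvalues are real, so that an eigenfunction and its conjugate satisfy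
    the transfer equation together.  This is why the indices [h <= m] suffice
    although there are [n] characters. *)
Lemma PST_branch (r c : nat -> C) x y tau :
  (forall h, (h <= m)%N -> branch_data h (r h) (c h)) -> (0 < tau)%N ->
  PST C (cayley S) x y tau <->
  x != y /\ forall h, (h <= m)%N ->
    transfers tau x y h (r h) (c h) /\ transfers tau x y h (- r h) (- c h).
Proof.
move=> rc tau_gt0; split=> [pst|[xy trans]].
  split=> [|h /rc rch]; first by case: pst; rewrite eq_sym.
  split; apply: (PST_eigenfunction cayley_sym card_conn_gt0 cayley_regular pst).
    exact: branch_eigenfunction.
  exact/branch_eigenfunction/branch_dataN.
apply: (PST_of_eigenfunctions cayley_sym card_conn_gt0 cayley_regular) => // z zorth.
have orth h r' c' : branch_data h r' c' -> transfers tau x y h r' c' ->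
    \sum_t branch h c' t * z t = 0 /\ \sum_t (branch h c' t)^* * z t = 0.
  move=> rch' tr; have muR := branch_eigenvalue_real rch'.
  have eig := branch_eigenfunction rch'.
  split; first exact: zorth eig tr.
  apply: (zorth (fun t => (branch h c' t)^*)); first exact: eigenfunction_conj muR eig.
  by rewrite -tr rmorphM /= (CrealP (chebyshevT_real tau muR)).
have sumB h c' : \sum_t branch h c' t * z t =
    \sum_t phi h t * z t + c' * \sum_t phi h t * z (b * t)%g.
  rewrite big_distrr [X in _ + X](reindex_inj (mulgI b)) -big_split /=.
  by apply: eq_bigr => t _; rewrite (reflK gT_dihedral) /branch mulrDl mulrA.
have sumBC h c' : \sum_t (branch h c' t)^* * z t =
    \sum_t (phi h t)^* * z t + c'^* * \sum_t (phi h t)^* * z (b * t)%g.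
  rewrite big_distrr [X in _ + X](reindex_inj (mulgI b)) -big_split /=.
  apply: eq_bigr => t _.
  by rewrite (reflK gT_dihedral) /branch rmorphD rmorphM mulrDl mulrA.
have split0 (X Y k : C) : k != 0 -> X + k * Y = 0 -> X - k * Y = 0 -> X = 0 /\ Y = 0.
  move=> k0 E1 E2; have X0 : X = 0.
    have : 2%:R * X = 0 by rewrite -[RHS](addr0 0) -{1}E1 -E2; ring.
    by move/eqP; rewrite mulf_eq0 pnatr_eq0 => /eqP.
  split=> //; move/eqP: E1; rewrite X0 add0r mulf_eq0 (negbTE k0) => /eqP //.
have total h : (h <= m)%N ->
    [/\ \sum_t phi h t * z t = 0, \sum_t phi h t * z (b * t)%g = 0,
        \sum_t (phi h t)^* * z t = 0 & \sum_t (phi h t)^* * z (b * t)%g = 0].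
  move=> hm; have [t1 t2] := trans h hm; have rch := rc h hm.
  have c0 : c h != 0.
    case: rch => _ cc _; apply: contra_eq_neq cc => ->.
    by rewrite mul0r eq_sym oner_eq0.
  have [] := orth _ _ _ rch t1; rewrite sumB sumBC => E1 E2.
  have [] := orth _ _ _ (branch_dataN rch) t2; rewrite sumB sumBC => E3 E4.
  rewrite rmorphN !mulNr /= in E3 E4.
  have [-> ->] := split0 _ _ _ c0 E1 E3.
  by have [|-> ->] := split0 _ _ _ _ E2 E4; rewrite ?conjC_eq0.
apply: (dihedral_elimT gT_dihedral) => k.
  apply: (@rot_char_total R gT n a b gT_dihedral m z); first by rewrite n_def.
  by move=> h /total[].
apply: (@rot_char_total R gT n a b gT_dihedral m (fun t => z (b * t)%g)).
  by rewrite n_def.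
by move=> h /total[].
Qed.

End CayleySpectrum.

(** * State transfer between labelled vertices *)

Lemma omega_half (R : realType) m : (0 < m)%N -> omega R (2 * m) ^+ m = -1.
Proof.
move=> m_gt0; have w_prim := omega_primitive R (_ : 0 < 2 * m)%N.
have {}w_prim : (2 * m).-primitive_root (omega R (2 * m)) by apply: w_prim; lia.
have : (omega R (2 * m) ^+ m) ^+ 2 == 1 ^+ 2.
  by rewrite -exprM (mulnC m 2) (prim_expr_order w_prim) expr1n.
rewrite eqf_sqr => /orP[|/eqP //].
by rewrite -(prim_order_dvd w_prim) => /dvdn_leq; lia.
Qed.

(** Two labels on the same side differ by less than [2 * m], so labels congruent
    modulo [m] and distinct are at distance exactly [m]. *)
Lemma eqmod_double_dist m u v :
  2 * u = 2 * v %[mod 2 * m] -> u <> v -> (u < v + 2 * m)%N -> (v < u + 2 * m)%N ->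
  (u = v + m \/ v = u + m)%N.
Proof.
move=> E uv lt1 lt2; have {}E : (u %% m = v %% m)%N.
  by apply/eqP; rewrite -(eqn_pmul2l (isT : 0 < 2)%N) !muln_modr E.
have := divn_eq v m; have := divn_eq u m; rewrite E.
move: (u %/ m)%N (v %/ m)%N (v %% m)%N => q q' r uE vE.
have [qq'|qq'|qq'] := ltngtP q q'; last by case: uv; rewrite uE vE qq'.
  have qE : q' = q.+1 by nia.
  by right; rewrite uE vE qE mulSn; lia.
have qE : q = q'.+1 by nia.
by left; rewrite uE vE qE mulSn; lia.
Qed.

(** The indices for which the plane of [phi h] is an irreducible
    two-dimensional representation; for [0] and [m] it splits into linear
    characters. *)
Definition inner (m h : nat) : bool := (1 <= h <= m - 1)%N.

Lemma inner_cases m h : (h <= m)%N -> [\/ h = 0%N, h = m | inner m h].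
Proof.
rewrite /inner => hm; case: (eqVneq h 0%N) => [->|h0]; first by constructor 1.
by case: (eqVneq h m) => [->|h1]; [constructor 2|constructor 3; lia].
Qed.

Lemma inner_le m h : inner m h -> (h <= m)%N.
Proof. by rewrite /inner; lia. Qed.

Lemma inner0 m : inner m 0 = false.
Proof. by []. Qed.

Lemma innerm m : (0 < m)%N -> inner m m = false.
Proof. by rewrite /inner; lia. Qed.

Section Translation.
Variables (R : realType) (gT : finGroupType) (m n : nat) (a b : gT) (S : {set gT}).
Hypothesis m_gt0 : (0 < m)%N.
Hypothesis n_def : n = (2 * m)%N.
Hypothesis gT_dihedral : dihedral_generators n a b.
Hypothesis S_neq0 : S != set0.
Hypothesis S_inv : S = (S^-1)%g.

Local Notation C := R[i].
Local Notation w := (omega R n).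
Local Notation d := (#|S|%:R : C).
Local Notation eta1 h := (eta_sum R n a h (conn1 a S)).
Local Notation eta2 h := (eta_sum R n a h (conn2 a b S)).
Local Notation eta2V h := (eta_sum R n a h (conn2 a b S)^-1%g).
Local Notation T tau x := ((chebyshevT C tau).[x]).
Local Notation vtx := (vertex n a b).

Let n_gt0 : (0 < n)%N := dihedral_n_gt0 gT_dihedral.
Let w_prim : n.-primitive_root w := omega_primitive R n_gt0.

Lemma omega_m : w ^+ m = -1.
Proof. by rewrite n_def omega_half. Qed.

Lemma omega_conjK k : w ^+ k * (w ^+ k)^* = 1.
Proof. by rewrite -normCK omega_norm ?expr1n. Qed.

Lemma eta_sum0 (K : {set gT}) : K \subset <[a]>%g -> eta_sum R n a 0 K = #|K|%:R.
Proof.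
move=> /subsetP Ka; rewrite eta_sumE -sumr_const; apply: eq_bigr => x /Ka /cycleP[k ->].
by rewrite (rot_char_rot _ gT_dihedral) mul0n.
Qed.

Lemma eta_sum_m (K : {set gT}) :
  eta_sum R n a m K = (even_count n a K)%:R - (odd_count n a K)%:R.
Proof.
rewrite /eta_sum (bigID (fun k : 'I_n => odd k)) /= addrC; congr (_ + _).
  rewrite /even_count cardsE -sumr_const; apply: eq_bigr => k /andP[_ kodd].
  by rewrite exprM omega_m -signr_odd (negbTE kodd).
rewrite /odd_count cardsE -sumr_const -sumrN; apply: eq_bigr => k /andP[_ kodd].
by rewrite exprM omega_m -signr_odd kodd.
Qed.

(** The factor [r] chosen in [eta_h(S_2) = r * c^*].  For [h = m] it is the sum
    itself, which may be negative, so that the branches come in the order of the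
    eigenvalues [mut3] and [mut4]. *)
Definition splitting h : C := if inner m h then sqrtC (eta2 h * eta2V h) else eta2 h.

(** The factor [c] chosen in [eta_h(S_2) = r * c^*].  When the sum vanishes,
    [ell] has no meaning and any unimodular number would do. *)
Definition phase h : C :=
  if inner m h && (eta2 h != 0) then ell R n a b S h else 1.


Lemma splitting_phase h : (h <= m)%N -> branch_data n a b S h (splitting h) (phase h).
Proof.
case/inner_cases => [->|->|hi];
  rewrite /splitting /phase ?inner0 ?(innerm m_gt0) ?hi /=.
- by split; rewrite ?conjC1 ?mulr1 ?eta_sum0 ?subsetIr ?realn.
- by split; rewrite ?conjC1 ?mulr1 // eta_sum_m rpredB ?realn.
rewrite (eta_sumV _ gT_dihedral).
have [eta0|eta_neq0] := eqVneq (eta2 h) 0; rewrite /=.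
  by split; rewrite ?conjC1 ?mulr1 ?eta0 ?mul0r ?sqrtC0.
have [E1 E2] := ellP eta_neq0; set l := ell _ _ _ _ _ _ in E1 E2 *.
have r_real : sqrtC (eta2 h * (eta2 h)^*) \is Num.real.
  by rewrite ger0_real // sqrtC_ge0 mul_conjC_ge0.
rewrite (eta_sumV _ gT_dihedral) in E1 E2.
have ll : l * l^* = 1.
  rewrite -normCK -normrX E1 normf_div norm_conjC divff // normr_eq0 //.
by split=> //; rewrite -E2 mulrAC ll mul1r.
Qed.

Lemma eigenvalue_0p : (eta1 0 + splitting 0) / d = mut1 R.
Proof.
rewrite /splitting inner0 !eta_sum0 ?subsetIr // -natrD -(card_conn S gT_dihedral).
by rewrite mulfV // pnatr_eq0 -lt0n card_gt0.
Qed.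

Lemma eigenvalue_0m : (eta1 0 - splitting 0) / d = mut2 R a b S.
Proof. by rewrite /splitting inner0 !eta_sum0 ?subsetIr. Qed.

Lemma eigenvalue_mp : (eta1 m + splitting m) / d = mut3 R n a b S.
Proof. by rewrite /splitting innerm // !eta_sum_m /mut3 addrA. Qed.

Lemma eigenvalue_mm : (eta1 m - splitting m) / d = mut4 R n a b S.
Proof. by rewrite /splitting innerm // !eta_sum_m /mut4 opprB addrA. Qed.

Lemma eigenvalue_hp h : inner m h -> (eta1 h + splitting h) / d = mu1 R n a b S h.
Proof. by rewrite /splitting => ->. Qed.

Lemma eigenvalue_hm h : inner m h -> (eta1 h - splitting h) / d = mu2 R n a b S h.
Proof. by rewrite /splitting => ->. Qed.

Lemma branch_vertex h c u : (u < 2 * n)%N ->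
  @branch R gT n a b h c (vtx u) = (if (u < n)%N then 1 else c) * w ^+ (h * u).
Proof.
move=> u_lt; rewrite /branch /vertex; case: ltnP => un.
  rewrite mul1r (rot_char_rot _ gT_dihedral) rot_char_out ?mulr0 ?addr0 //.
  by rewrite (mem_refl_mul gT_dihedral) negbK mem_cycle.
rewrite rot_char_out ?add0r; last first.
  rewrite -(reflK gT_dihedral (b * _)%g) (mem_refl_mul gT_dihedral).
  by rewrite (reflK gT_dihedral) negbK mem_cycle.
rewrite (reflK gT_dihedral) (rot_char_rot _ gT_dihedral) -{2}(subnK un) mulnDr exprD.
by rewrite [(h * n)%N]mulnC [w ^+ (n * h)]exprM (prim_expr_order w_prim) expr1n mulr1.
Qed.

Lemma vertex_inj u v : (u < 2 * n)%N -> (v < 2 * n)%N -> vtx u = vtx v -> u = v.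
Proof.
have rot_inj i j : (i < n)%N -> (j < n)%N -> (a ^+ i = a ^+ j)%g -> i = j.
  move=> ii jj /eqP; rewrite eq_expg_mod_order (rot_order gT_dihedral).
  by rewrite !modn_small // => /eqP.
have disj i j : (a ^+ i)%g <> (b * a ^+ j)%g.
  move=> E; have := mem_cycle a i; rewrite E (mem_refl_mul gT_dihedral).
  by rewrite mem_cycle.
move=> u_lt v_lt; rewrite /vertex; case: ltnP => un; case: ltnP => vn.
- exact: rot_inj.
- by move/disj.
- by move/esym/disj.
by move/mulgI/rot_inj => E; rewrite -(subnK un) -(subnK vn) E //; lia.
Qed.

(** A real unimodular number has square 1, so that [c ^ 2 * omega ^ (2 * D * h)]
    is 1, that is, [eta_h(S_2) = omega ^ (2 * D * h) * eta_h(S_2)^*].  The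
    right side is the h-th Fourier sum of [a ^ (2 * D) S_2^-1]. *)
Lemma conn2_reflection_invariant D :
  (forall h, (h <= m)%N -> phase h * w ^+ (D * h) \is Num.real) ->
  conn2 a b S = (a ^+ (2 * D) *: (conn2 a b S)^-1)%g.
Proof.
move=> phaseR; apply: (@eta_sum_inj R _ n a b gT_dihedral m).
- by rewrite n_def.
- exact: subsetIr.
- apply/subsetP => x; rewrite mem_lcoset inE => /setIP[_].
  by rewrite groupV groupMl ?groupV ?mem_cycle.
move=> h hm; rewrite (eta_sum_translate _ gT_dihedral) (eta_sumV _ gT_dihedral).
have [/CrealP rR cc ->] := splitting_phase hm.
have /CrealP cwR := phaseR h hm; move: (phase h) cc cwR => c cc cwR.
have -> : w ^+ (h * (2 * D)) = (w ^+ (D * h)) ^+ 2.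
  by rewrite -exprM; congr (_ ^+ _); lia.
rewrite rmorphM /= conjCK rR.
have cw2 : (c * w ^+ (D * h)) * (c * w ^+ (D * h)) = 1.
  rewrite -{2}cwR rmorphM /= mulrACA cc mul1r.
  by rewrite -normCK omega_norm ?expr1n.
rewrite -[LHS]mulr1 -cw2 -[RHS]mul1r -cc; ring.
Qed.

Section Walk.
Variables (u v tau : nat).
Hypothesis u_lt : (u < 2 * n)%N.
Hypothesis v_lt : (v < 2 * n)%N.
Hypothesis tau_gt0 : (0 < tau)%N.

Local Notation tp h := (T tau ((eta1 h + splitting h) / d)).
Local Notation tm h := (T tau ((eta1 h - splitting h) / d)).
Local Notation pst := (PST C (cayley S) (vtx u) (vtx v) tau).

Lemma tp_real h : (h <= m)%N -> tp h \is Num.real.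
Proof.
move/splitting_phase => bd; apply: chebyshevT_real.
exact: branch_eigenvalue_real bd.
Qed.

Lemma tm_real h : (h <= m)%N -> tm h \is Num.real.
Proof.
move/splitting_phase/branch_dataN => bd; apply: chebyshevT_real.
exact: branch_eigenvalue_real bd.
Qed.

Let side (c : C) x : C := if (x < n)%N then 1 else c.

Lemma PST_tp_tm :
  pst <-> u != v /\ forall h, (h <= m)%N ->
    tp h * (side (phase h) u * w ^+ (h * u)) = side (phase h) v * w ^+ (h * v) /\
    tm h * (side (- phase h) u * w ^+ (h * u)) = side (- phase h) v * w ^+ (h * v).
Proof.
have E := PST_branch n_def gT_dihedral S_neq0 S_inv (vtx u) (vtx v)
  splitting_phase tau_gt0.
split=> [/E[uv tr]|[uv tr]]; [|apply/E]; split.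
- by apply: contraNneq uv => ->.
- by move=> h /tr[]; rewrite /transfers !branch_vertex.
- by apply: contraNneq uv => /vertex_inj ->.
by move=> h /tr[]; rewrite /transfers !branch_vertex.
Qed.

Lemma phase_norm h : (h <= m)%N -> phase h * (phase h)^* = 1.
Proof. by case/splitting_phase. Qed.

Lemma phase_neq0 h : (h <= m)%N -> phase h != 0.
Proof.
by move/phase_norm; apply: contra_eq_neq => ->; rewrite mul0r eq_sym oner_eq0.
Qed.

Lemma unit_real_sqr (x : C) : x \is Num.real -> x * x^* = 1 -> x * x = 1.
Proof. by move=> /CrealP ->. Qed.

(** At both vertices an eigenfunction takes the same multiple of a power of
    [omega]; once this factor cancels, the quotient of the two powers is a value
    of a Chebyshev polynomial at a real number. *)
Lemma PST_same_side : (u < n)%N = (v < n)%N ->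
  pst <-> (u%:Z - v%:Z = m%:Z \/ u%:Z - v%:Z = - m%:Z) /\
          forall h, (h <= m)%N -> tp h = (-1) ^+ h /\ tm h = (-1) ^+ h.
Proof.
move=> uv_side.
have side_neq0 c : c != 0 -> side c u != 0.
  by rewrite /side; case: ifP; rewrite ?oner_eq0.
have sideE c : side c v = side c u by rewrite /side uv_side.
have pstE : pst <-> u != v /\ forall h, (h <= m)%N ->
    tp h * w ^+ (h * u) = w ^+ (h * v) /\ tm h * w ^+ (h * u) = w ^+ (h * v).
  split=> [/PST_tp_tm[uv tr]|[uv tr]]; [|apply/PST_tp_tm]; split=> // h hm;
    have := tr h hm; rewrite !sideE !(mulrCA _ (side _ _)) => -[E1 E2].
    have c0 := phase_neq0 hm.
    split; first exact: (mulfI (side_neq0 _ c0)) E1.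
    by apply: (mulfI (side_neq0 (- phase h) _)) E2; rewrite oppr_eq0.
  by rewrite E1 E2.
have shift_m h i : w ^+ (h * (i + m)) = (-1) ^+ h * w ^+ (h * i).
  by rewrite mulnDr exprD mulrC [(h * m)%N]mulnC [w ^+ (m * h)]exprM omega_m.
have cancel_w h t i : t * w ^+ (h * i) = (-1) ^+ h * w ^+ (h * i) -> t = (-1) ^+ h.
  by move/(mulIf (omega_neq0 R (h * i) n_gt0)).
have uvE : (u%:Z - v%:Z = m%:Z \/ u%:Z - v%:Z = - m%:Z) <-> (u = v + m \/ v = u + m)%N.
  by split; lia.
have qE h : (u = v + m \/ v = u + m)%N -> w ^+ (h * v) = (-1) ^+ h * w ^+ (h * u).
  by case=> ->; rewrite shift_m // mulrA -exprMn mulrNN mulr1 expr1n mul1r.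
split=> [/pstE[uv tr]|[/uvE uvm tr]].
  have uvm : (u = v + m \/ v = u + m)%N.
    (* For h = 1 the quotient of the two powers of omega is real and unimodular,
       hence omega ^+ (2 * u) = omega ^+ (2 * v). *)
    have [E _] := tr 1%N m_gt0; rewrite !mul1n in E.
    have t_real := tp_real m_gt0.
    have t1 : tp 1%N * tp 1%N = 1.
      apply: unit_real_sqr => //.
      have := omega_conjK v; rewrite -E rmorphM /= mulrACA omega_conjK mulr1 //.
    have /eqP : w ^+ (2 * u) = w ^+ (2 * v).
      by rewrite !(mulnC 2%N) !exprM -E exprMn (expr2 (T _ _)) t1 mul1r.
    rewrite (eq_prim_root_expr w_prim) n_def => /eqP /eqmod_double_dist.
    by apply; [apply/eqP|lia|lia].
  split; first exact/uvE.
  move=> h hm; have [E1 E2] := tr h hm; rewrite (qE h uvm) in E1 E2.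
  by split; [exact: cancel_w E1|exact: cancel_w E2].
apply/pstE; split; first by apply/eqP; lia.
by move=> h hm; have [-> ->] := tr h hm; rewrite qE.
Qed.

(** Going from a reflection to a rotation puts the phase on the other side of
    the transfer equation; this makes no difference, as [t] is then 1 or -1. *)
Lemma real_unit_inverse (t x : C) :
  t \is Num.real -> x * x^* = 1 -> (t * x = 1 <-> t = x).
Proof.
move=> /CrealP tR xx; split=> [tx|tx]; last by rewrite -xx -tx tR.
have x0 : x != 0 by apply: contra_eq_neq xx => ->; rewrite mul0r eq_sym oner_eq0.
have tE : t = x^* by apply: (mulIf x0); rewrite tx mulrC xx.
by rewrite -tR tE conjCK.
Qed.

Lemma PST_cross_side : (u < n)%N != (v < n)%N ->
  let D := `|v%:Z - u%:Z|%N in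
  pst <-> forall h, (h <= m)%N -> tp h = phase h * w ^+ (D * h) /\
                               - tm h = phase h * w ^+ (D * h).
Proof.
move=> uv_side D.
have uv : u != v by apply: contraNneq uv_side => ->.
suff stepE h : (h <= m)%N ->
    (tp h * (side (phase h) u * w ^+ (h * u)) = side (phase h) v * w ^+ (h * v) /\
     tm h * (side (- phase h) u * w ^+ (h * u)) = side (- phase h) v * w ^+ (h * v)) <->
    (tp h = phase h * w ^+ (D * h) /\ - tm h = phase h * w ^+ (D * h)).
  split=> [/PST_tp_tm[_ tr] h hm|tr]; first exact/stepE/tr.
  by apply/PST_tp_tm; split=> // h hm; apply/stepE/tr.
move=> hm; have tpR := tp_real hm; have tmR := tm_real hm.
have cc := phase_norm hm; move: (phase h) cc tpR tmR => c cc.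
move: (tp h) (tm h) => t1 t2 t1R t2R; rewrite (mulnC D) /side.
have wD i : w ^+ (h * (i + D)) = w ^+ (h * D) * w ^+ (h * i).
  by rewrite mulnDr exprD mulrC.
have cancel_w i (x y : C) : x * w ^+ (h * i) = y * w ^+ (h * i) <-> x = y.
  by split=> [/(mulIf (omega_neq0 R (h * i) n_gt0))|->].
have xx : (c * w ^+ (h * D)) * (c * w ^+ (h * D))^* = 1.
  by rewrite rmorphM /= mulrACA cc omega_conjK mul1r.
case: ltnP uv_side => un; case: ltnP => vn // _.
  have -> : v = (u + D)%N by lia.
  rewrite !wD !mul1r !mulrA !cancel_w mulNr.
  by split=> -[-> E]; split=> //; [rewrite E opprK|rewrite -E opprK].
have -> : u = (v + D)%N by lia.
rewrite !wD !mulrA -!(mulrA _ c) -(mulrA _ (- c)) !cancel_w.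
have E1 := real_unit_inverse t1R xx.
have E2 : - t2 * (c * w ^+ (h * D)) = 1 <-> - t2 = c * w ^+ (h * D).
  by apply: real_unit_inverse; rewrite // rpredN.
have -> : t2 * (- c * w ^+ (h * D)) = - t2 * (c * w ^+ (h * D)) by ring.
by split=> -[/E1 ? /E2 ?].
Qed.

End Walk.
End Translation.

(** * The characterization *)

Theorem theorem4p3 (R : realType) (gT : finGroupType) (m n : nat) (a b : gT)
    (S : {set gT}) (u v tau : nat)
    (m_gt0 : (0 < m)%N) (n_def : n = (2 * m)%N)
    (gT_dihedral : dihedral_generators n a b)
    (S_neq0 : S != set0) (S_1 : (1 : gT)%g \notin S) (S_inv : S = S^-1%g)
    (S_nonnormal : ~ normal_connection_set S)
    (u_lt : (u < 2 * n)%N) (v_lt : (v < 2 * n)%N) (tau_gt0 : (0 < tau)%N) :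
  let T (x : R[i]) := (chebyshevT R[i] tau).[x] in
  let dist := `|v%:Z - u%:Z|%N in
  PST R[i] (cayley S) (vertex n a b u) (vertex n a b v) tau <->
  exactly_one
    ([/\ (u \in G0 n /\ v \in G0 n) \/ (u \in G1 n /\ v \in G1 n),
         u%:Z - v%:Z = m%:Z \/ u%:Z - v%:Z = - m%:Z,
         [/\ T (mut1 R) = 1, T (mut2 R a b S) = 1,
             T (mut3 R n a b S) = (-1) ^+ m & T (mut4 R n a b S) = (-1) ^+ m],
         forall h : nat, (1 <= h <= m - 1)%N ->
           eta_sum R n a h (conn2 a b S) = 0 -> T (mu R n a S h) = (-1) ^+ h
       & forall h : nat, (1 <= h <= m - 1)%N ->
           eta_sum R n a h (conn2 a b S) <> 0 ->
           T (mu1 R n a b S h) = (-1) ^+ h /\ T (mu2 R n a b S h) = (-1) ^+ h])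
    ([/\ (u \in G0 n /\ v \in G1 n) \/ (u \in G1 n /\ v \in G0 n),
         forall h : nat, (1 <= h <= m - 1)%N -> eta_sum R n a h (conn2 a b S) <> 0,
         conn2 a b S = (a ^+ (2 * dist) *: (conn2 a b S)^-1)%g,
         [/\ T (mut1 R) = 1, - T (mut2 R a b S) = 1,
             T (mut3 R n a b S) = (-1) ^+ (u + v)
           & - T (mut4 R n a b S) = (-1) ^+ (u + v)]
       & forall h : nat, (1 <= h <= m - 1)%N ->
           T (mu1 R n a b S h) = ell R n a b S h * omega R n ^+ (dist * h) /\
           - T (mu2 R n a b S h) = ell R n a b S h * omega R n ^+ (dist * h)]).
Proof.
move=> T dist.
have G0E x : (x \in G0 n) = (x < n)%N by [].
have G1E x : (x \in G1 n) = (n <= x < 2 * n)%N by [].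
have sides h : splitting R m n a b S h = 0 -> inner m h ->
    (mu1 R n a b S h = mu R n a S h) /\ (mu2 R n a b S h = mu R n a S h).
  by rewrite /splitting /mu1 /mu2 => + hi; rewrite hi => ->; rewrite subr0 addr0.
have splitting_eq0 h : inner m h ->
    eta_sum R n a h (conn2 a b S) = 0 -> splitting R m n a b S h = 0.
  by move=> hi eta0; rewrite /splitting hi eta0 mul0r sqrtC0.
have [same|cross] := eqVneq (u < n)%N (v < n)%N.
  set A := (X in exactly_one X _); set B := (X in exactly_one _ X).
  have notB : ~ B.
    by case=> -[[]|[]]; rewrite !G0E !G1E => uS vS _ _ _ _; lia.
  suff AE : PST R[i] (cayley S) (vertex n a b u) (vertex n a b v) tau <-> A.
    by split=> [/AE ?|[[/AE //]|[_ /notB]//]]; left.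
  have E := PST_same_side R m_gt0 n_def gT_dihedral S_neq0 S_inv u_lt v_lt tau_gt0 same.
  have sidesP : (u \in G0 n /\ v \in G0 n) \/ (u \in G1 n /\ v \in G1 n).
    by rewrite !G0E !G1E u_lt v_lt !andbT; case: ltnP same; case: ltnP => //; auto.
  split=> [/E[uvm tr]|[_ uvm [T1 T2 T3 T4] tr0 tr1]].
    split=> //.
    - have [] := tr 0%N (leq0n m); rewrite eigenvalue_0p // eigenvalue_0m // => E1 E2.
      by have [] := tr m (leqnn m); rewrite eigenvalue_mp // eigenvalue_mm.
    - move=> h hi eta0; have [<- _] := sides h (splitting_eq0 h hi eta0) hi.
      by rewrite -(eigenvalue_hp R n a b S hi); apply: (tr h _).1; apply: inner_le.
    move=> h hi _; rewrite -(eigenvalue_hp R n a b S hi) -(eigenvalue_hm R n a b S hi).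
    exact/tr/inner_le.
  apply/E; split=> // h /inner_cases[->|->|hi].
  - by rewrite eigenvalue_0p // eigenvalue_0m.
  - by rewrite eigenvalue_mp // eigenvalue_mm.
  rewrite (eigenvalue_hp R n a b S hi) (eigenvalue_hm R n a b S hi).
  have [eta0|/eqP eta_neq0] := eqVneq (eta_sum R n a h (conn2 a b S)) 0.
    by have [-> ->] := sides h (splitting_eq0 h hi eta0) hi; split; apply: tr0.
  exact: tr1.
set A := (X in exactly_one X _); set B := (X in exactly_one _ X).
have notA : ~ A.
  by case=> -[[]|[]]; rewrite ?G0E ?G1E => uS vS _ _ _ _; lia.
suff BE : PST R[i] (cayley S) (vertex n a b u) (vertex n a b v) tau <-> B.
  by split=> [/BE ?|[[/notA]//|[_ /BE//]]]; right.
have E := PST_cross_side R m_gt0 n_def gT_dihedral S_neq0 S_inv u_lt v_lt tau_gt0 cross.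
have sidesP : (u \in G0 n /\ v \in G1 n) \/ (u \in G1 n /\ v \in G0 n).
  rewrite !G0E !G1E u_lt v_lt !andbT.
  by case: (ltnP u n) cross; case: (ltnP v n) => // _ _ _; [left|right].
have sign_uv : omega R n ^+ (dist * m) = (-1) ^+ (u + v).
  rewrite mulnC exprM (omega_m R m_gt0 n_def) -[RHS]signr_odd.
  have -> : odd (u + v) = odd dist by rewrite /dist; lia.
  by rewrite signr_odd.
have phase_out h : inner m h = false -> phase R m n a b S h = 1 by rewrite /phase => ->.
have phase_in h : inner m h -> eta_sum R n a h (conn2 a b S) != 0 ->
    phase R m n a b S h = ell R n a b S h by rewrite /phase => -> ->.
split=> [/E tr|[_ eta_neq0 _ [T1 T2 T3 T4] tr]].
  (* If the sum vanishes the two branches have the same eigenvalue, whose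
     Chebyshev value would be its own opposite and yet unimodular. *)
  have eta_neq0 h : inner m h -> eta_sum R n a h (conn2 a b S) != 0.
    move=> hi; have hm := inner_le hi; apply/eqP => eta0.
    have [E1 E2] := tr h hm; move: E1 E2; rewrite (splitting_eq0 h hi eta0) subr0 addr0.
    move=> -> /eqP; rewrite -subr_eq0 -opprD oppr_eq0 -mulr2n mulrn_eq0 /=.
    rewrite mulf_eq0 (negbTE (phase_neq0 R S m_gt0 n_def gT_dihedral hm)) /=.
    by rewrite (negbTE (omega_neq0 _ _ (dihedral_n_gt0 gT_dihedral))).
  split=> //.
  - by move=> h hi; apply/eqP/eta_neq0.
  - apply: (@conn2_reflection_invariant R gT m n a b S) => // h hm.
    by have [<- _] := tr h hm; apply: tp_real.
  - have [] := tr 0%N (leq0n m); rewrite eigenvalue_0p // eigenvalue_0m //.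
    rewrite phase_out // muln0 mul1r => E1 E2.
    have [] := tr m (leqnn m).
    rewrite eigenvalue_mp // eigenvalue_mm // phase_out ?innerm //.
    by rewrite sign_uv mul1r.
  move=> h hi; rewrite -(eigenvalue_hp R n a b S hi) -(eigenvalue_hm R n a b S hi).
  by rewrite -(phase_in h hi (eta_neq0 h hi)); apply/tr/inner_le.
apply/E => h /inner_cases[->|->|hi].
- by rewrite eigenvalue_0p // eigenvalue_0m // phase_out // muln0 mul1r.
- by rewrite eigenvalue_mp // eigenvalue_mm // phase_out ?innerm // sign_uv mul1r.
rewrite (eigenvalue_hp R n a b S hi) (eigenvalue_hm R n a b S hi).
rewrite phase_in //; first exact: tr.
exact/eqP/eta_neq0.
Qed.
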